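(* If $\mathbf{B}$ is a bicategory in which all maps are comonadic and $\mathrm{Map}\,\mathbf{B}$ has a terminal object, then $\mathrm{Map}\,\mathbf{B}$ is locally essentially discrete; that is, for all objects $X$ and $A$ the category $\mathrm{Map}\,\mathbf{B}(X,A)$ is equivalent to a discrete category.
   Context: A map in a bicategory $\mathbf{B}$ is an arrow $f$ having a right adjoint $f^*$, with unit $\eta_f:1\to f^*f$ and counit $\epsilon_f:ff^*\to 1$. $\mathrm{Map}\,\mathbf{B}$ is the locally full subbicategory of $\mathbf{B}$ with the same objects, the maps as arrows, and all 2-cells between them. A terminal object of a bicategory is meant in the bicategorical sense (each hom category into it is equivalent to the terminal category). An Eilenberg-Moore object for a comonad $(A,G,\epsilon,\delta)$ in $\mathbf{B}$ is an object $A_G$ with an arrow $g:A_G\to A$ and a counital, coassociative coaction $\gamma:g\to Gg$ such that for every $X$ composition with $(g,\gamma)$ is an equivalence from $\mathbf{B}(X,A_G)$ to the category of $G$-coalgebras with domain $X$ (arrows $F:X\to A$ with counital, coassociative $F\to GF$). A map $g:X\to A$ is comonadic if $X$ with $g$ and $g\eta_g:g\to gg^*g$ is an Eilenberg-Moore object for the comonad $gg^*$ on $A$. *)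

(* Defs.v *)
From Stdlib Require Import ssreflect ProofIrrelevance.

Set Implicit Arguments.
Unset Strict Implicit.
Unset Printing Implicit Defensive.

Declare Scope bicat_scope.
Delimit Scope bicat_scope with bicat.
Local Open Scope bicat_scope.

#[local] Obligation Tactic := idtac.

Reserved Notation "b • a" (at level 51, right associativity).
Reserved Notation "g ∘ f" (at level 40, left associativity).
Reserved Notation "b ⊗ a" (at level 43, no associativity).
Reserved Notation "g ◁ a" (at level 43, no associativity).
Reserved Notation "b ▷ f" (at level 43, no associativity).
Reserved Notation "i ⁻¹" (at level 1, format "i ⁻¹").

Record Category := {
  obj :> Type;
  mor : obj -> obj -> Type;
  idm : forall a, mor a a;
  vcomp : forall a b c, mor b c -> mor a b -> mor a c;
  vcomp1m : forall a b (f : mor a b), vcomp (idm b) f = f;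
  vcompm1 : forall a b (f : mor a b), vcomp f (idm a) = f;
  vcompA : forall a b c d (h : mor c d) (g : mor b c) (f : mor a b),
    vcomp (vcomp h g) f = vcomp h (vcomp g f)
}.

Arguments idm {C} a : rename.
Arguments vcomp {C a b c} _ _ : rename.

Notation "b • a" := (vcomp b a) : bicat_scope.

Record Functor (C D : Category) := {
  fobj :> C -> D;
  fmor : forall a b, mor a b -> mor (fobj a) (fobj b);
  fmor_id : forall a, fmor (idm a) = idm (fobj a);
  fmor_comp : forall a b c (g : mor b c) (f : mor a b),
    fmor (g • f) = fmor g • fmor f
}.

Record iso (C : Category) (a b : C) := {
  fwd :> mor a b;
  bwd : mor b a;
  fwdK : bwd • fwd = idm a;
  bwdK : fwd • bwd = idm b
}.

Notation "i ⁻¹" := (bwd i) : bicat_scope.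

Program Definition functor_id (C : Category) : Functor C C :=
  {| fobj := fun a => a; fmor := fun _ _ f => f |}.
Next Obligation. by []. Qed.
Next Obligation. by []. Qed.

Program Definition functor_comp (C D E : Category)
    (G : Functor D E) (F : Functor C D) : Functor C E :=
  {| fobj := fun a => G (F a); fmor := fun _ _ f => fmor G (fmor F f) |}.
Next Obligation. by move=> * /=; rewrite !fmor_id. Qed.
Next Obligation. by move=> * /=; rewrite !fmor_comp. Qed.

Record NatIso (C D : Category) (F G : Functor C D) := {
  component :> forall a : C, iso (F a) (G a);
  component_natural : forall a b (f : mor a b),
    fmor G f • component a = component b • fmor F f
}.

Definition is_equivalence (C D : Category) (F : Functor C D) : Prop :=
  exists G : Functor D C,
    inhabited (NatIso (functor_comp G F) (functor_id C)) /\
    inhabited (NatIso (functor_comp F G) (functor_id D)).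

Definition equivalent (C D : Category) : Prop :=
  exists F : Functor C D, is_equivalence F.

Program Definition terminal_category : Category :=
  {| obj := unit; mor := fun _ _ => unit;
     idm := fun _ => tt; vcomp := fun _ _ _ _ _ => tt |}.
Next Obligation. by move=> ? ? []. Qed.
Next Obligation. by move=> ? ? []. Qed.
Next Obligation. by []. Qed.

(* The only arrows are the identities; the two clauses avoid transporting an
   arrow along an equality of objects. *)
Definition is_discrete (C : Category) : Prop :=
  (forall (a b : C) (f : mor a b), a = b) /\
  (forall (a : C) (f : mor a a), f = idm a).

Definition essentially_discrete (C : Category) : Prop :=
  exists D : Category, is_discrete D /\ equivalent C D.

Program Definition full_subcategory (C : Category) (P : C -> Prop) : Category :=
  {| obj := {a : C | P a};
     mor := fun a b => mor (proj1_sig a) (proj1_sig b);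
     idm := fun a => idm (proj1_sig a);
     vcomp := fun _ _ _ g f => g • f |}.
Next Obligation. by move=> * /=; rewrite vcomp1m. Qed.
Next Obligation. by move=> * /=; rewrite vcompm1. Qed.
Next Obligation. by move=> * /=; rewrite vcompA. Qed.

(* Both compositions are in applicative order: [comp1 g f] is [f] followed by [g]. *)
Record Bicategory := {
  bob :> Type;
  arr : bob -> bob -> Category;
  id1 : forall A, arr A A;
  comp1 : forall A B C, arr B C -> arr A B -> arr A C;
  hcomp : forall A B C (g g' : arr B C) (f f' : arr A B),
    mor g g' -> mor f f' -> mor (comp1 g f) (comp1 g' f');
  hcomp_id : forall A B C (g : arr B C) (f : arr A B),
    hcomp (idm g) (idm f) = idm (comp1 g f);
  hcomp_vcomp : forall A B C (g g' g'' : arr B C) (f f' f'' : arr A B)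
      (b' : mor g' g'') (b : mor g g') (a' : mor f' f'') (a : mor f f'),
    hcomp (b' • b) (a' • a) = hcomp b' a' • hcomp b a;
  assoc : forall A B C D (h : arr C D) (g : arr B C) (f : arr A B),
    iso (comp1 (comp1 h g) f) (comp1 h (comp1 g f));
  lunit : forall A B (f : arr A B), iso (comp1 (id1 B) f) f;
  runit : forall A B (f : arr A B), iso (comp1 f (id1 A)) f;
  assoc_natural : forall A B C D (h h' : arr C D) (g g' : arr B C)
      (f f' : arr A B) (c : mor h h') (b : mor g g') (a : mor f f'),
    assoc h' g' f' • hcomp (hcomp c b) a = hcomp c (hcomp b a) • assoc h g f;
  lunit_natural : forall A B (f f' : arr A B) (a : mor f f'),
    lunit f' • hcomp (idm (id1 B)) a = a • lunit f;
  runit_natural : forall A B (f f' : arr A B) (a : mor f f'),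
    runit f' • hcomp a (idm (id1 A)) = a • runit f;
  pentagon : forall A B C D E (k : arr D E) (h : arr C D) (g : arr B C)
      (f : arr A B),
    assoc k h (comp1 g f) • assoc (comp1 k h) g f =
    hcomp (idm k) (assoc h g f) • assoc k (comp1 h g) f
      • hcomp (assoc k h g) (idm f);
  triangle : forall A B C (g : arr B C) (f : arr A B),
    hcomp (idm g) (lunit f) • assoc g (id1 B) f = hcomp (runit g) (idm f)
}.

Arguments id1 {b} A : rename.
Arguments comp1 {b A B C} _ _ : rename.
Arguments hcomp {b A B C g g' f f'} _ _ : rename.
Arguments assoc {b A B C D} h g f : rename.
Arguments lunit {b A B} f : rename.
Arguments runit {b A B} f : rename.

Notation "g ∘ f" := (comp1 g f) : bicat_scope.
Notation "b ⊗ a" := (hcomp b a) : bicat_scope.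
Notation "g ◁ a" := (hcomp (idm g) a) : bicat_scope.
Notation "b ▷ f" := (hcomp b (idm f)) : bicat_scope.

Definition is_terminal (B : Bicategory) (T : B) : Prop :=
  forall X : B, equivalent (arr X T) terminal_category.

Definition locally_essentially_discrete (B : Bicategory) : Prop :=
  forall X A : B, essentially_discrete (arr X A).

Lemma vcomp_l (C : Category) (a b c : C) (g g' : mor b c) (f : mor a b) :
  g = g' -> g • f = g' • f.
Proof. by move=> ->. Qed.

Lemma vcomp_r (C : Category) (a b c : C) (g : mor b c) (f f' : mor a b) :
  f = f' -> g • f = g • f'.
Proof. by move=> ->. Qed.

Lemma reassoc (C : Category) (a b c : C) (g : mor b c) (f : mor a b) k :
  g • f = k -> forall z (h : mor z a), g • f • h = k • h.
Proof. by move=> <- z h; rewrite vcompA. Qed.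

Lemma fwdKr (C : Category) (a b : C) (i : iso a b) z (h : mor z a) :
  i⁻¹ • i • h = h.
Proof. by rewrite -vcompA fwdK vcomp1m. Qed.

Lemma bwdKr (C : Category) (a b : C) (i : iso a b) z (h : mor z b) :
  i • i⁻¹ • h = h.
Proof. by rewrite -vcompA bwdK vcomp1m. Qed.

Lemma iso_epi (C : Category) (a b c : C) (i : iso a b) (f g : mor b c) :
  f • i = g • i -> f = g.
Proof.
move=> H; rewrite -(vcompm1 f) -(vcompm1 g) -(bwdK i) -!vcompA.
by rewrite H.
Qed.

Lemma iso_mono (C : Category) (a b c : C) (i : iso b c) (f g : mor a b) :
  i • f = i • g -> f = g.
Proof. by move=> H; rewrite -(fwdKr i f) H fwdKr. Qed.

Lemma iso_flip (C : Category) (a a' b b' : C) (i : iso a b) (j : iso a' b')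
    (f : mor a a') (g : mor b b') :
  j • f = g • i -> f • i⁻¹ = j⁻¹ • g.
Proof.
by move=> H; apply: (iso_mono (i := j)); rewrite bwdKr -vcompA H vcompA bwdK vcompm1.
Qed.

Lemma lwhisker_vcomp (B : Bicategory) (X Y Z : B) (g : arr Y Z)
    (f f' f'' : arr X Y) (b : mor f' f'') (a : mor f f') :
  g ◁ (b • a) = (g ◁ b) • (g ◁ a).
Proof. by rewrite -hcomp_vcomp vcomp1m. Qed.

Lemma rwhisker_vcomp (B : Bicategory) (X Y Z : B) (g g' g'' : arr Y Z)
    (f : arr X Y) (b : mor g' g'') (a : mor g g') :
  (b • a) ▷ f = (b ▷ f) • (a ▷ f).
Proof. by rewrite -hcomp_vcomp vcomp1m. Qed.

Lemma exchange (B : Bicategory) (X Y Z : B) (g g' : arr Y Z) (f f' : arr X Y)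
    (b : mor g g') (a : mor f f') :
  (g' ◁ a) • (b ▷ f) = (b ▷ f') • (g ◁ a).
Proof. by rewrite -!hcomp_vcomp !vcomp1m !vcompm1. Qed.

Program Definition lwhisker_iso (B : Bicategory) (X Y Z : B) (g : arr Y Z)
    (f f' : arr X Y) (i : iso f f') : iso (g ∘ f) (g ∘ f') :=
  {| fwd := g ◁ i; bwd := g ◁ i⁻¹ |}.
Next Obligation. by move=> * /=; rewrite -lwhisker_vcomp fwdK hcomp_id. Qed.
Next Obligation. by move=> * /=; rewrite -lwhisker_vcomp bwdK hcomp_id. Qed.

Program Definition rwhisker_iso (B : Bicategory) (X Y Z : B) (g g' : arr Y Z)
    (f : arr X Y) (i : iso g g') : iso (g ∘ f) (g' ∘ f) :=
  {| fwd := i ▷ f; bwd := i⁻¹ ▷ f |}.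
Next Obligation. by move=> * /=; rewrite -rwhisker_vcomp fwdK hcomp_id. Qed.
Next Obligation. by move=> * /=; rewrite -rwhisker_vcomp bwdK hcomp_id. Qed.

Lemma assoc_natural_l (B : Bicategory) (W X Y Z : B) (h h' : arr Y Z)
    (g : arr X Y) (f : arr W X) (c : mor h h') :
  assoc h' g f • ((c ▷ g) ▷ f) = (c ▷ (g ∘ f)) • assoc h g f.
Proof. by rewrite assoc_natural hcomp_id. Qed.

Lemma assoc_natural_r (B : Bicategory) (W X Y Z : B) (h : arr Y Z)
    (g : arr X Y) (f f' : arr W X) (a : mor f f') :
  assoc h g f' • ((h ∘ g) ◁ a) = (h ◁ (g ◁ a)) • assoc h g f.
Proof. by rewrite -assoc_natural hcomp_id. Qed.

Lemma assocV_natural (B : Bicategory) (W X Y Z : B) (h h' : arr Y Z)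
    (g g' : arr X Y) (f f' : arr W X) (c : mor h h') (b : mor g g')
    (a : mor f f') :
  ((c ⊗ b) ⊗ a) • (assoc h g f)⁻¹ = (assoc h' g' f')⁻¹ • (c ⊗ (b ⊗ a)).
Proof. by apply: iso_flip; rewrite assoc_natural. Qed.

Lemma assocV_natural_l (B : Bicategory) (W X Y Z : B) (h h' : arr Y Z)
    (g : arr X Y) (f : arr W X) (c : mor h h') :
  ((c ▷ g) ▷ f) • (assoc h g f)⁻¹ = (assoc h' g f)⁻¹ • (c ▷ (g ∘ f)).
Proof. by rewrite assocV_natural hcomp_id. Qed.

Lemma assocV_natural_r (B : Bicategory) (W X Y Z : B) (h : arr Y Z)
    (g : arr X Y) (f f' : arr W X) (a : mor f f') :
  ((h ∘ g) ◁ a) • (assoc h g f)⁻¹ = (assoc h g f')⁻¹ • (h ◁ (g ◁ a)).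
Proof. by rewrite -assocV_natural hcomp_id. Qed.

Lemma lunitV_natural (B : Bicategory) (X Y : B) (f f' : arr X Y)
    (a : mor f f') :
  (lunit f')⁻¹ • a = (id1 Y ◁ a) • (lunit f)⁻¹.
Proof. by symmetry; apply: iso_flip; rewrite lunit_natural. Qed.

Lemma runitV_natural (B : Bicategory) (X Y : B) (f f' : arr X Y)
    (a : mor f f') :
  (runit f')⁻¹ • a = (a ▷ id1 X) • (runit f)⁻¹.
Proof. by symmetry; apply: iso_flip; rewrite runit_natural. Qed.

Lemma lwhisker_id1_inj (B : Bicategory) (X Y : B) (f f' : arr X Y)
    (a b : mor f f') : id1 Y ◁ a = id1 Y ◁ b -> a = b.
Proof.
by move=> H; apply: (iso_epi (i := lunit f)); rewrite -!lunit_natural H.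
Qed.

Lemma rwhisker_id1_inj (B : Bicategory) (X Y : B) (f f' : arr X Y)
    (a b : mor f f') : a ▷ id1 X = b ▷ id1 X -> a = b.
Proof.
by move=> H; apply: (iso_epi (i := runit f)); rewrite -!runit_natural H.
Qed.

Lemma lunit_comp1 (B : Bicategory) (X Y Z : B) (g : arr Y Z) (f : arr X Y) :
  lunit (g ∘ f) • assoc (id1 Z) g f = lunit g ▷ f.
Proof.
apply: lwhisker_id1_inj; rewrite lwhisker_vcomp.
apply: (iso_epi (i := assoc (id1 Z) (id1 Z ∘ g) f)).
apply: (iso_epi (i := rwhisker_iso f (assoc (id1 Z) (id1 Z) g))) => /=.
rewrite !vcompA -pentagon -vcompA triangle.
rewrite -(vcompA (id1 Z ◁ (lunit g ▷ f))) -assoc_natural vcompA.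
by rewrite -rwhisker_vcomp triangle assoc_natural_l.
Qed.

Lemma runit_comp1 (B : Bicategory) (X Y Z : B) (g : arr Y Z) (f : arr X Y) :
  fwd (runit (g ∘ f)) = (g ◁ runit f) • assoc g f (id1 X).
Proof.
apply: rwhisker_id1_inj; rewrite rwhisker_vcomp.
apply: (iso_mono (i := assoc g f (id1 X))).
rewrite -triangle -vcompA assoc_natural_r vcompA pentagon -!vcompA.
by rewrite -lwhisker_vcomp triangle assoc_natural.
Qed.

Lemma lunit_id1 (B : Bicategory) (X : B) : fwd (lunit (id1 X)) = runit (id1 X).
Proof.
apply: rwhisker_id1_inj; rewrite -triangle -lunit_comp1.
congr (_ • _); apply: (iso_mono (i := lunit (id1 X))).
by rewrite lunit_natural.
Qed.

Record RightAdjoint (B : Bicategory) (X A : B) (f : arr X A) := {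
  radj :> arr A X;
  runi : mor (id1 X) (radj ∘ f);
  rcou : mor (f ∘ radj) (id1 A);
  radj_triangle_l :
    lunit f • (rcou ▷ f) • (assoc f radj f)⁻¹ • (f ◁ runi) = runit f;
  radj_triangle_r :
    runit radj • (radj ◁ rcou) • assoc radj f radj • (runi ▷ radj) = lunit radj
}.

Arguments runi {B X A f} r : rename.
Arguments rcou {B X A f} r : rename.

Definition is_map (B : Bicategory) (X A : B) (f : arr X A) : Prop :=
  inhabited (RightAdjoint f).

Program Definition id_radj (B : Bicategory) (X : B) : RightAdjoint (id1 X) :=
  {| radj := id1 X; runi := (lunit (id1 X))⁻¹; rcou := lunit (id1 X) |}.
Next Obligation.
move=> B X /=; rewrite lunit_id1 -triangle vcompA bwdKr.
by rewrite -lwhisker_vcomp bwdK hcomp_id vcompm1.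
Qed.
Next Obligation.
move=> B X /=; rewrite -(vcompA (id1 X ◁ lunit (id1 X))) triangle -lunit_id1.
by rewrite -rwhisker_vcomp bwdK hcomp_id vcompm1.
Qed.

Definition transpose (B : Bicategory) (X A : B) (f : arr X A)
    (u : RightAdjoint f) (W : B) (a : arr W X) (b : arr W A)
    (s : mor (f ∘ a) b) : mor a (u ∘ b) :=
  (u ◁ s) • assoc u f a • (runi u ▷ a) • (lunit a)⁻¹.

Definition untranspose (B : Bicategory) (X A : B) (f : arr X A)
    (u : RightAdjoint f) (W : B) (a : arr W X) (b : arr W A)
    (t : mor a (u ∘ b)) : mor (f ∘ a) b :=
  lunit b • (rcou u ▷ b) • (assoc f u b)⁻¹ • (f ◁ t).

Arguments transpose {B X A f} u {W a b} s.
Arguments untranspose {B X A f} u {W a b} t.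

Lemma transpose_natural_l (B : Bicategory) (X A : B) (f : arr X A)
    (u : RightAdjoint f) (W : B) (a : arr W X) (b b' : arr W A)
    (s' : mor b b') (s : mor (f ∘ a) b) :
  transpose u (s' • s) = (u ◁ s') • transpose u s.
Proof. by rewrite /transpose lwhisker_vcomp !vcompA. Qed.

Lemma transpose_natural_r (B : Bicategory) (X A : B) (f : arr X A)
    (u : RightAdjoint f) (W : B) (a a' : arr W X) (b : arr W A)
    (s : mor (f ∘ a) b) (t : mor a' a) :
  transpose u (s • (f ◁ t)) = transpose u s • t.
Proof.
rewrite /transpose lwhisker_vcomp !vcompA lunitV_natural.
rewrite (reassoc (eq_sym (exchange _ _))) !vcompA.
by rewrite (reassoc (assoc_natural_r _ _ _)) !vcompA.
Qed.

Lemma triangleV (B : Bicategory) (X Y Z : B) (g : arr Y Z) (f : arr X Y) :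
  (assoc g (id1 Y) f)⁻¹ • (g ◁ (lunit f)⁻¹) = (runit g)⁻¹ ▷ f.
Proof.
apply: (iso_mono (i := assoc g (id1 Y) f)); rewrite bwdKr.
apply: (iso_mono (i := lwhisker_iso g (lunit f))) => /=.
rewrite -lwhisker_vcomp bwdK hcomp_id -vcompA triangle.
by rewrite -rwhisker_vcomp bwdK hcomp_id.
Qed.

Lemma lunitV_comp1 (B : Bicategory) (X Y Z : B) (g : arr Y Z) (f : arr X Y) :
  (lunit (g ∘ f))⁻¹ = assoc (id1 Z) g f • ((lunit g)⁻¹ ▷ f).
Proof.
apply: (iso_mono (i := lunit (g ∘ f))); rewrite bwdK -vcompA lunit_comp1.
by rewrite -rwhisker_vcomp bwdK hcomp_id.
Qed.

Lemma runitV_comp1 (B : Bicategory) (X Y Z : B) (g : arr Y Z) (f : arr X Y) :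
  (runit (g ∘ f))⁻¹ = (assoc g f (id1 X))⁻¹ • (g ◁ (runit f)⁻¹).
Proof.
apply: (iso_mono (i := runit (g ∘ f))); rewrite bwdK runit_comp1 vcompA bwdKr.
by rewrite -lwhisker_vcomp bwdK hcomp_id.
Qed.

Lemma pentagon_l (B : Bicategory) (V W X Y Z : B) (k : arr Y Z) (h : arr X Y)
    (g : arr W X) (f : arr V W) :
  (k ◁ (assoc h g f)⁻¹) • assoc k h (g ∘ f) • assoc (k ∘ h) g f =
  assoc k (h ∘ g) f • (assoc k h g ▷ f).
Proof.
by rewrite pentagon -vcompA -lwhisker_vcomp fwdK hcomp_id vcomp1m.
Qed.

Lemma pentagon_m (B : Bicategory) (V W X Y Z : B) (k : arr Y Z) (h : arr X Y)
    (g : arr W X) (f : arr V W) :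
  (assoc k h (g ∘ f))⁻¹ • (k ◁ assoc h g f) =
  assoc (k ∘ h) g f • ((assoc k h g)⁻¹ ▷ f) • (assoc k (h ∘ g) f)⁻¹.
Proof.
apply: (iso_mono (i := assoc k h (g ∘ f))); rewrite bwdKr.
rewrite (reassoc (pentagon _ _ _ _)) !vcompA.
rewrite -(vcompA (assoc k h g ▷ f)) -rwhisker_vcomp bwdK hcomp_id vcomp1m.
by rewrite bwdK vcompm1.
Qed.

Lemma transpose_whisker (B : Bicategory) (X A : B) (f : arr X A)
    (u : RightAdjoint f) (V W : B) (a : arr W X) (b : arr W A)
    (s : mor (f ∘ a) b) (c : arr V W) :
  transpose u ((s ▷ c) • (assoc f a c)⁻¹) = assoc u b c • (transpose u s ▷ c).
Proof.
rewrite /transpose lunitV_comp1 lwhisker_vcomp !rwhisker_vcomp !vcompA.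
rewrite (reassoc (eq_sym (assoc_natural_l _ _ _))) !vcompA.
rewrite -(vcompA (assoc u f (a ∘ c))) -(vcompA (u ◁ (assoc f a c)⁻¹)).
by rewrite pentagon_l !vcompA (reassoc (eq_sym (assoc_natural _ _ _))) !vcompA.
Qed.

Lemma transpose_counit (B : Bicategory) (X A : B) (f : arr X A)
    (u : RightAdjoint f) : transpose u (rcou u) = (runit u)⁻¹.
Proof.
apply: (iso_mono (i := runit u)); rewrite bwdK /transpose.
move: (radj_triangle_r u) => /(vcomp_l (lunit u)⁻¹).
by rewrite !vcompA bwdK.
Qed.

Lemma untransposeK (B : Bicategory) (X A : B) (f : arr X A)
    (u : RightAdjoint f) (W : B) (a : arr W X) (b : arr W A)
    (t : mor a (u ∘ b)) : transpose u (untranspose u t) = t.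
Proof.
have -> : untranspose u t =
    (lunit b • (rcou u ▷ b) • (assoc f u b)⁻¹) • (f ◁ t).
  by rewrite /untranspose !vcompA.
rewrite transpose_natural_r transpose_natural_l.
rewrite transpose_whisker transpose_counit -(vcompA (radj u ◁ lunit b)) triangle.
by rewrite -rwhisker_vcomp bwdK hcomp_id vcomp1m.
Qed.

Lemma transposeK (B : Bicategory) (X A : B) (f : arr X A)
    (u : RightAdjoint f) (W : B) (a : arr W X) (b : arr W A)
    (s : mor (f ∘ a) b) : untranspose u (transpose u s) = s.
Proof.
rewrite /untranspose /transpose !lwhisker_vcomp.
rewrite (reassoc (eq_sym (assocV_natural_r f u s))) !vcompA.
rewrite (reassoc (eq_sym (exchange _ _))) !vcompA (reassoc (lunit_natural _)) !vcompA.
rewrite (reassoc (pentagon_m _ _ _ _)) !vcompA.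
rewrite (reassoc (eq_sym (assocV_natural _ _ _))) !vcompA.
rewrite (reassoc (eq_sym (assoc_natural_l _ _ _))).
rewrite !vcompA (reassoc (lunit_comp1 _ _)).
rewrite triangleV.
rewrite -!rwhisker_vcomp.
move: (radj_triangle_l u) => /(vcomp_l (runit f)⁻¹).
by rewrite !vcompA bwdK => ->; rewrite hcomp_id vcompm1.
Qed.

Definition comp_transpose (B : Bicategory) (X Y Z : B) (g : arr Y Z)
    (f : arr X Y) (v : RightAdjoint g) (u : RightAdjoint f) (W : B)
    (a : arr W X) (b : arr W Z) (s : mor (g ∘ f ∘ a) b) : mor a (u ∘ v ∘ b) :=
  (assoc u v b)⁻¹ • transpose u (transpose v (s • (assoc g f a)⁻¹)).

Section CompAdjoint.

Context {B : Bicategory} {X Y Z : B} {g : arr Y Z} {f : arr X Y}.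
Context (v : RightAdjoint g) (u : RightAdjoint f).

Lemma comp_transpose_inj (W : B) (a : arr W X) (b : arr W Z)
    (s t : mor (g ∘ f ∘ a) b) :
  comp_transpose v u s = comp_transpose v u t -> s = t.
Proof.
move=> H; apply: (iso_epi (i := Build_iso (bwdK (assoc g f a)) (fwdK _))) => /=.
rewrite -(transposeK v (_ • _)) -(transposeK u (transpose v _)).
rewrite -(bwdKr (assoc u v b) (transpose u _)) -/(comp_transpose v u s) H.
by rewrite /comp_transpose bwdKr !transposeK.
Qed.

Lemma comp_transpose_natural_l (W : B) (a : arr W X) (b b' : arr W Z)
    (s' : mor b b') (s : mor (g ∘ f ∘ a) b) :
  comp_transpose v u (s' • s) = (u ∘ v ◁ s') • comp_transpose v u s.
Proof.
rewrite /comp_transpose -vcompA assocV_natural_r !vcompA.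
by rewrite -!transpose_natural_l.
Qed.

Lemma comp_transpose_natural_r (W : B) (a a' : arr W X) (b : arr W Z)
    (s : mor (g ∘ f ∘ a) b) (t : mor a' a) :
  comp_transpose v u (s • (g ∘ f ◁ t)) = comp_transpose v u s • t.
Proof.
by rewrite /comp_transpose vcompA assocV_natural_r -vcompA !transpose_natural_r vcompA.
Qed.

Lemma comp_transpose_whisker (V W : B) (a : arr W X) (b : arr W Z)
    (s : mor (g ∘ f ∘ a) b) (c : arr V W) :
  comp_transpose v u ((s ▷ c) • (assoc (g ∘ f) a c)⁻¹) =
  assoc (u ∘ v) b c • (comp_transpose v u s ▷ c).
Proof.
rewrite /comp_transpose.
set w := s • _.
have -> : ((s ▷ c) • (assoc (g ∘ f) a c)⁻¹) • (assoc g f (a ∘ c))⁻¹ =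
    ((w ▷ c) • (assoc g (f ∘ a) c)⁻¹) • (g ◁ (assoc f a c)⁻¹).
  apply: (iso_epi (i := assoc g f (a ∘ c))).
  apply: (iso_epi (i := assoc (g ∘ f) a c)).
  rewrite !vcompA fwdKr fwdK vcompm1 pentagon_l fwdKr -rwhisker_vcomp.
  by rewrite /w vcompA fwdK vcompm1.
rewrite transpose_natural_r transpose_whisker vcompA transpose_natural_l.
rewrite transpose_whisker rwhisker_vcomp -!vcompA; congr (_ • _).
apply: (iso_mono (i := assoc u v (b ∘ c))); rewrite -!vcompA bwdK vcomp1m.
by rewrite pentagon !vcompA -rwhisker_vcomp bwdK hcomp_id vcompm1.
Qed.

Definition comp_counit : mor (g ∘ f ∘ (u ∘ v)) (id1 Z) :=
  untranspose v (untranspose u (assoc u v (id1 Z) • (runit (u ∘ v))⁻¹))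
  • assoc g f (u ∘ v).

Lemma comp_transpose_counit :
  comp_transpose v u comp_counit = (runit (u ∘ v))⁻¹.
Proof.
by rewrite /comp_transpose /comp_counit vcompA bwdK vcompm1 !untransposeK fwdKr.
Qed.

Program Definition comp_radj : RightAdjoint (g ∘ f) :=
  {| radj := u ∘ v;
     runi := comp_transpose v u (runit (g ∘ f));
     rcou := comp_counit |}.
Next Obligation.
apply: comp_transpose_inj; rewrite -!vcompA comp_transpose_natural_r.
rewrite (vcompA (lunit (g ∘ f))) comp_transpose_natural_l
  comp_transpose_whisker comp_transpose_counit.
rewrite -(vcompA (u ∘ v ◁ lunit (g ∘ f))) triangle.
set w := comp_transpose v u _; rewrite -vcompA -rwhisker_vcomp bwdK hcomp_id.
by rewrite vcomp1m.
Qed.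
Next Obligation.
rewrite -comp_transpose_whisker -triangle vcompA bwdK vcompm1.
rewrite -comp_transpose_natural_l comp_transpose_natural_r.
by rewrite comp_transpose_counit bwdKr.
Qed.

End CompAdjoint.

Lemma is_map_id1 (B : Bicategory) (X : B) : is_map (id1 X).
Proof. exact: inhabits (id_radj X). Qed.

Lemma is_map_comp1 (B : Bicategory) (X Y Z : B) (g : arr Y Z) (f : arr X Y) :
  is_map g -> is_map f -> is_map (g ∘ f).
Proof. by move=> [v] [u]; exact: inhabits (comp_radj v u). Qed.

Definition full_iso (C : Category) (P : C -> Prop) (a b : full_subcategory P)
    (i : iso (proj1_sig a) (proj1_sig b)) : iso a b :=
  @Build_iso (full_subcategory P) a b (fwd i) (bwd i) (fwdK i) (bwdK i).

Definition map_arr (B : Bicategory) (X A : B) : Category :=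
  full_subcategory (@is_map B X A).

Definition map_id1 (B : Bicategory) (X : B) : map_arr X X :=
  exist _ (id1 X) (is_map_id1 X).

Definition map_comp1 (B : Bicategory) (X Y Z : B) (g : map_arr Y Z)
    (f : map_arr X Y) : map_arr X Z :=
  exist _ (proj1_sig g ∘ proj1_sig f)
    (is_map_comp1 (proj2_sig g) (proj2_sig f)).

Definition Map (B : Bicategory) : Bicategory :=
  @Build_Bicategory B (@map_arr B) (@map_id1 B) (@map_comp1 B)
    (fun X Y Z g g' f f' (b : mor g g') (a : mor f f') =>
       hcomp (b : mor (proj1_sig g) (proj1_sig g'))
             (a : mor (proj1_sig f) (proj1_sig f')))
    (fun X Y Z g f => hcomp_id (proj1_sig g) (proj1_sig f))
    (fun X Y Z g g' g'' f f' f'' b' b a' a =>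
       @hcomp_vcomp B X Y Z _ _ _ _ _ _ b' b a' a)
    (fun W X Y Z h g f =>
       full_iso (a := map_comp1 (map_comp1 h g) f)
                (b := map_comp1 h (map_comp1 g f))
         (assoc (proj1_sig h) (proj1_sig g) (proj1_sig f)))
    (fun X Y f =>
       full_iso (a := map_comp1 (map_id1 Y) f) (lunit (proj1_sig f)))
    (fun X Y f =>
       full_iso (a := map_comp1 f (map_id1 X)) (runit (proj1_sig f)))
    (fun W X Y Z h h' g g' f f' c b a =>
       @assoc_natural B W X Y Z _ _ _ _ _ _ c b a)
    (fun X Y f f' a => @lunit_natural B X Y _ _ a)
    (fun X Y f f' a => @runit_natural B X Y _ _ a)
    (fun V W X Y Z k h g f =>
       pentagon (proj1_sig k) (proj1_sig h) (proj1_sig g) (proj1_sig f))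
    (fun X Y Z g f => triangle (proj1_sig g) (proj1_sig f)).

Record Comonad (B : Bicategory) (A : B) := {
  cmd :> arr A A;
  ccou : mor cmd (id1 A);
  cdup : mor cmd (cmd ∘ cmd);
  ccou_l : lunit cmd • (ccou ▷ cmd) • cdup = idm cmd;
  ccou_r : runit cmd • (cmd ◁ ccou) • cdup = idm cmd;
  cdupA : assoc cmd cmd cmd • (cdup ▷ cmd) • cdup = (cmd ◁ cdup) • cdup
}.

Arguments ccou {B A} c : rename.
Arguments cdup {B A} c : rename.

Record Coalgebra (B : Bicategory) (A : B) (G : Comonad A) (X : B) := {
  carrier :> arr X A;
  coact : mor carrier (G ∘ carrier);
  coact_counit : lunit carrier • (ccou G ▷ carrier) • coact = idm carrier;
  coactA : assoc G G carrier • (cdup G ▷ carrier) • coact = (G ◁ coact) • coact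
}.

Arguments coact {B A G X} c : rename.

Lemma sig_val_inj (T : Type) (P : T -> Prop) (x y : {z : T | P z}) :
  proj1_sig x = proj1_sig y -> x = y.
Proof. by case: x y => [x Px] [y Py] /= H; apply: subset_eq_compat. Qed.

Program Definition coalgebra_category (B : Bicategory) (A : B) (G : Comonad A)
    (X : B) : Category :=
  {| obj := Coalgebra G X;
     mor := fun F F' =>
       {a : @mor (arr X A) F F' | (G ◁ a) • coact F = coact F' • a};
     idm := fun F => exist _ (idm (carrier F)) _;
     vcomp := fun F F' F'' b a =>
       exist _ (proj1_sig b • proj1_sig a) _ |}.
Next Obligation. by move=> * /=; rewrite hcomp_id vcomp1m vcompm1. Qed.
Next Obligation.
move=> B A G X F F' F'' [b Hb] [a Ha] /=.
by rewrite lwhisker_vcomp vcompA Ha -!vcompA Hb.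
Qed.
Next Obligation. by move=> *; apply: sig_val_inj; apply: vcomp1m. Qed.
Next Obligation. by move=> *; apply: sig_val_inj; apply: vcompm1. Qed.
Next Obligation. by move=> *; apply: sig_val_inj; apply: vcompA. Qed.

Lemma whisker_coact_counit (B : Bicategory) (A P X : B) (G : arr A A)
    (eps : mor G (id1 A)) (g : arr P A) (gam : mor g (G ∘ g)) (h : arr X P) :
  lunit g • (eps ▷ g) • gam = idm g ->
  lunit (g ∘ h) • (eps ▷ (g ∘ h)) • assoc G g h • (gam ▷ h) = idm (g ∘ h).
Proof.
move=> H; rewrite (reassoc (eq_sym (assoc_natural_l _ _ _))) !vcompA.
by rewrite (reassoc (lunit_comp1 _ _)) -!rwhisker_vcomp H hcomp_id.
Qed.

Lemma whisker_coactA (B : Bicategory) (A P X : B) (G : arr A A)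
    (del : mor G (G ∘ G)) (g : arr P A) (gam : mor g (G ∘ g)) (h : arr X P) :
  assoc G G g • (del ▷ g) • gam = (G ◁ gam) • gam ->
  assoc G G (g ∘ h) • (del ▷ (g ∘ h)) • assoc G g h • (gam ▷ h) =
  (G ◁ (assoc G g h • (gam ▷ h))) • assoc G g h • (gam ▷ h).
Proof.
move=> H; rewrite (reassoc (eq_sym (assoc_natural_l _ _ _))) !vcompA.
rewrite (reassoc (pentagon _ _ _ _)) !vcompA -!rwhisker_vcomp H.
by rewrite rwhisker_vcomp (reassoc (assoc_natural _ _ _)) lwhisker_vcomp !vcompA.
Qed.

(* [h |-> (c h, c h -> (G c) h ~ G (c h))], composition with [(c, coact c)]. *)
Program Definition comparison (B : Bicategory) (A : B) (G : Comonad A) (P : B)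
    (c : Coalgebra G P) (X : B) : Functor (arr X P) (coalgebra_category G X) :=
  {| fobj := fun h =>
       {| carrier := carrier c ∘ h;
          coact := assoc G c h • (coact c ▷ h);
          coact_counit := whisker_coact_counit h (coact_counit c);
          coactA := whisker_coactA h (coactA c) |}
         : coalgebra_category G X;
     fmor := fun h h' a => exist _ (carrier c ◁ a) _ |}.
Next Obligation.
move=> * /=; rewrite (reassoc (eq_sym (assoc_natural_r _ _ _))) !vcompA.
by rewrite exchange.
Qed.
Next Obligation. by move=> *; apply: sig_val_inj; apply: hcomp_id. Qed.
Next Obligation. by move=> *; apply: sig_val_inj; apply: lwhisker_vcomp. Qed.

Definition is_EM_object (B : Bicategory) (A : B) (G : Comonad A) (P : B)
    (c : Coalgebra G P) : Prop :=
  forall X : B, is_equivalence (comparison c X).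

(* [g eta_g : g -> (gg* )g] *)
Definition adj_coact (B : Bicategory) (X A : B) (g : arr X A)
    (r : RightAdjoint g) : mor g (g ∘ r ∘ g) :=
  (assoc g r g)⁻¹ • (g ◁ runi r) • (runit g)⁻¹.

(* [g eta_g g* : gg* -> (gg* )(gg* )] *)
Definition adj_cdup (B : Bicategory) (X A : B) (g : arr X A)
    (r : RightAdjoint g) : mor (g ∘ r) (g ∘ r ∘ (g ∘ r)) :=
  assoc (g ∘ r) g r • (adj_coact r ▷ r).

Lemma adj_coact_counit (B : Bicategory) (X A : B) (g : arr X A)
    (r : RightAdjoint g) :
  lunit g • (rcou r ▷ g) • adj_coact r = idm g.
Proof.
move: (radj_triangle_l r) => /(vcomp_l (runit g)⁻¹).
by rewrite /adj_coact !vcompA bwdK.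
Qed.

Lemma adj_coactA (B : Bicategory) (X A : B) (g : arr X A)
    (r : RightAdjoint g) :
  assoc (g ∘ r) (g ∘ r) g • (adj_cdup r ▷ g) • adj_coact r =
  (g ∘ r ◁ adj_coact r) • adj_coact r.
Proof.
rewrite /adj_cdup; set k := adj_coact r.
have Hk : k = (assoc g r g)⁻¹ • (g ◁ runi r) • (runit g)⁻¹ by [].
clearbody k; rewrite {2}Hk rwhisker_vcomp !vcompA.
rewrite (reassoc (assocV_natural_l _ _ _)) !vcompA.
rewrite (reassoc (eq_sym (exchange _ _))) !vcompA -runitV_natural.
rewrite {2}Hk !lwhisker_vcomp runitV_comp1 !vcompA.
rewrite (reassoc (assocV_natural_r _ _ _)) !vcompA.
apply: (iso_mono (i := lwhisker_iso (g ∘ r) (assoc g r g))) => /=.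
rewrite -(vcompA (assoc (g ∘ r) (g ∘ r) g)) (reassoc (eq_sym (pentagon _ _ _ _))).
rewrite !vcompA !bwdKr.
by rewrite -(vcompA (g ∘ r ◁ assoc g r g)) -lwhisker_vcomp bwdK hcomp_id vcomp1m.
Qed.

Lemma adj_cdup_counit_r (B : Bicategory) (X A : B) (g : arr X A)
    (r : RightAdjoint g) :
  runit (g ∘ r) • (g ∘ r ◁ rcou r) • adj_cdup r = idm (g ∘ r).
Proof.
have -> : adj_cdup r = (assoc g r (g ∘ r))⁻¹
    • (g ◁ (assoc r g r • (runi r ▷ r) • (lunit r)⁻¹)).
  rewrite !lwhisker_vcomp (reassoc (pentagon_m _ _ _ _)) !vcompA.
  rewrite (reassoc (eq_sym (assocV_natural _ _ _))) !vcompA triangleV.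
  by rewrite /adj_cdup /adj_coact !rwhisker_vcomp.
rewrite (reassoc (assocV_natural_r _ _ _)) !vcompA runit_comp1 vcompA bwdKr.
rewrite -!lwhisker_vcomp.
move: (radj_triangle_r r) => /(vcomp_l (lunit r)⁻¹).
by rewrite !vcompA bwdK => ->; rewrite hcomp_id.
Qed.

Definition adj_comonad (B : Bicategory) (X A : B) (g : arr X A)
    (r : RightAdjoint g) : Comonad A :=
  {| cmd := g ∘ r;
     ccou := rcou r;
     cdup := adj_cdup r;
     ccou_l := whisker_coact_counit r (adj_coact_counit r);
     ccou_r := adj_cdup_counit_r r;
     cdupA := whisker_coactA r (adj_coactA r) |}.

Definition adj_coalgebra (B : Bicategory) (X A : B) (g : arr X A)
    (r : RightAdjoint g) : Coalgebra (adj_comonad r) X :=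
  {| carrier := g;
     coact := adj_coact r : mor g (adj_comonad r ∘ g);
     coact_counit := adj_coact_counit r;
     coactA := adj_coactA r |}.

(* The right adjoint of [g] is unique up to isomorphism, so this does not depend
   on the choice of [r]. *)
Definition comonadic (B : Bicategory) (X A : B) (g : arr X A)
    (r : RightAdjoint g) : Prop :=
  is_EM_object (adj_coalgebra r).

(* Main.v *)
From Stdlib Require Import ssreflect ProofIrrelevance ClassicalEpsilon.
From Stdlib Require Import FunctionalExtensionality PropExtensionality.
Require Import Defs.

(** Composition with the map [t : A -> 1] is, up to an equivalence, the forgetful
    functor from coalgebras, so it is faithful and reflects isomorphisms. Since [1]
    is terminal among maps, any two 2-cells between maps into [1] are equal and
    all of them are invertible; hence the same holds for maps [X -> A]. *)

Local Open Scope bicat_scope.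

#[local] Obligation Tactic := idtac.

(** Naturality of [eta : G F -> 1] gives [f • eta a = eta b • fmor G (fmor F f)], and [eta a] is
    invertible, so [fmor F f] determines [f]. *)
Lemma equivalence_faithful (C D : Category) (F : Functor C D) :
  is_equivalence F ->
  forall (a b : C) (f g : mor a b), fmor F f = fmor F g -> f = g.
Proof.
move=> [G [[eta] _]] a b f g Hfg; apply: (iso_epi (i := eta a)).
move: (component_natural eta f) (component_natural eta g) => /= -> ->.
by rewrite Hfg.
Qed.

Lemma equivalence_full (C D : Category) (F : Functor C D) :
  is_equivalence F ->
  forall (a b : C) (m : mor (F a) (F b)), exists f : mor a b, fmor F f = m.
Proof.
move=> [G [[eta] [theta]]] a b m.
have HG : is_equivalence G by exists F; split; apply: inhabits.
(* The conjugate of [fmor G m] by [eta]. As [G] is faithful, it suffices to compare images under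
   [G], where naturality of [eta] applies. *)
exists (eta b • fmor G m • (eta a)⁻¹); apply: (equivalence_faithful _ _ _ HG).
apply: (iso_mono (i := eta b)).
move: (component_natural eta (eta b • fmor G m • (eta a)⁻¹)) => /= <-.
by rewrite !vcompA fwdK vcompm1.
Qed.

Definition thin (C : Category) : Prop :=
  forall (a b : C) (f g : mor a b), f = g.

Program Definition thin_iso (C : Category) (thinC : thin C) (a b : C)
    (f : mor a b) (g : mor b a) : iso a b := {| fwd := f; bwd := g |}.
Next Obligation. by move=> C thinC *; exact: thinC. Qed.
Next Obligation. by move=> C thinC *; exact: thinC. Qed.

Lemma equivalence_thin (C D : Category) (F : Functor C D) :
  is_equivalence F -> thin D -> thin C.
Proof. by move=> HF thinD a b f g; apply: (equivalence_faithful _ _ _ HF). Qed.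

Lemma equivalent_terminal_thin (C : Category) :
  equivalent C terminal_category -> thin C.
Proof.
by move=> [F HF]; apply: (equivalence_thin _ _ _ HF) => ? ? [] [].
Qed.

Lemma equivalent_terminal_connected (C : Category) (a b : C) :
  equivalent C terminal_category -> inhabited (mor a b).
Proof. by move=> [F HF]; case: (equivalence_full _ _ _ HF a b tt) => f _. Qed.

Section ThinGroupoid.

Context (C : Category) (thinC : thin C).
Context (symC : forall a b : C, mor a b -> inhabited (mor b a)).

Definition representative (a : C) : C :=
  epsilon (inhabits a) (fun b => inhabited (mor a b)).

Lemma mor_representative (a : C) : inhabited (mor a (representative a)).
Proof.
apply: (epsilon_spec (inhabits a) (fun b => inhabited (mor a b))).
by exists a; apply: inhabits (idm a).
Qed.

(** Objects joined by an arrow in either direction reach the same objects, so [epsilon] is applied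
    to equal predicates and makes the same choice. *)
Lemma representative_eq (a b : C) :
  mor a b -> representative a = representative b.
Proof.
move=> f; case: (symC _ _ f) => g; rewrite /representative.
rewrite (proof_irrelevance _ (inhabits a) (inhabits b)); congr (epsilon _ _).
apply: functional_extensionality => c; apply: propositional_extensionality.
by split=> -[h]; apply: inhabits; [exact: (h • g) | exact: (h • f)].
Qed.

Lemma representativeK (a : C) :
  representative (representative a) = representative a.
Proof. by case: (mor_representative a) => f; rewrite -(representative_eq _ _ f). Qed.

(** Taking equalities as arrows makes the category discrete by construction, and its laws are
    instances of proof irrelevance. *)
Program Definition skeleton : Category :=
  {| obj := {a : C | representative a = a};
     mor := fun a b => a = b;
     idm := fun a => eq_refl;
     vcomp := fun a b c g f => eq_trans f g |}.
Next Obligation. by move=> *; apply: proof_irrelevance. Qed.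
Next Obligation. by move=> *; apply: proof_irrelevance. Qed.
Next Obligation. by move=> *; apply: proof_irrelevance. Qed.

Lemma skeleton_thin : thin skeleton.
Proof. by move=> a b f g; exact: (proof_irrelevance (a = b)). Qed.

Program Definition to_skeleton : Functor C skeleton :=
  {| fobj := fun a => exist _ (representative a) (representativeK a)
       : skeleton;
     fmor := fun a b f => sig_val_inj _ |}.
Next Obligation. by move=> a b f /=; apply: representative_eq. Qed.
Next Obligation. by move=> *; apply: skeleton_thin. Qed.
Next Obligation. by move=> *; apply: skeleton_thin. Qed.

Program Definition of_skeleton : Functor skeleton C :=
  {| fobj := fun a : skeleton => proj1_sig a;
     fmor := fun a b (e : a = b) =>
       match e in _ = c return mor (proj1_sig a) (proj1_sig c) with
       | eq_refl => idm (proj1_sig a)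
       end |}.
Next Obligation. by move=> *; apply: thinC. Qed.
Next Obligation. by move=> *; apply: thinC. Qed.

Lemma thin_groupoid_essentially_discrete : essentially_discrete C.
Proof.
exists skeleton; split; first by split=> // *; apply: skeleton_thin.
exists to_skeleton, of_skeleton; split; apply: inhabits.
- unshelve refine {| component := _ |}; last by move=> *; apply: thinC.
  move=> a /=.
  (* The components of a [NatIso] are data, whereas only the inhabitation of the two hom types is
     known; description extracts an arrow each way, and thinness makes them inverse. *)
  have [f _] : {f : mor a (representative a) | True}.
    apply: constructive_indefinite_description.
    by case: (mor_representative a) => f; exists f.
  have [g _] : {g : mor (representative a) a | True}.
    apply: constructive_indefinite_description.
    by case: (symC _ _ f) => g; exists g.
  exact: thin_iso thinC _ _ g f.
- unshelve refine {| component := _ |}; last by move=> *; apply: skeleton_thin.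
  have e a : to_skeleton (of_skeleton a) = a.
    by apply: sig_val_inj; apply: (proj2_sig a).
  move=> a; exact: (thin_iso _ skeleton_thin _ _ (e a) (eq_sym (e a))).
Qed.

End ThinGroupoid.

Section ComonadicComposition.

Context (B : Bicategory) (A T : B) (t : arr A T) (r : RightAdjoint t).
Context (comonadic_t : comonadic r).
Context (X : B) (f g : arr X A).

(** The comparison functor is an equivalence whose action on a 2-cell has underlying 2-cell
    [t ◁ a]. *)
Lemma comonadic_faithful (a b : mor f g) : t ◁ a = t ◁ b -> a = b.
Proof.
move=> Hab; apply: (equivalence_faithful _ _ _ (comonadic_t X)).
exact: sig_val_inj.
Qed.

(* The inverse of a coalgebra morphism is a coalgebra morphism. *)
Lemma comonadic_reflects_inverse (a : mor f g) (b : mor (t ∘ g) (t ∘ f)) :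
  b • (t ◁ a) = idm (t ∘ f) -> (t ◁ a) • b = idm (t ∘ g) ->
  exists c : mor g f, t ◁ c = b.
Proof.
move=> ba ab; pose K := comparison (adj_coalgebra r) X.
have Hb : (adj_comonad r ◁ b) • coact (K g : Coalgebra _ _)
    = coact (K f : Coalgebra _ _) • b.
  (* Inserting [(t ◁ a) • b] on the right brings in the coalgebra square of [fmor K a]; then
     [b • (t ◁ a)] cancels under [G]. *)
  rewrite -[LHS]vcompm1 -ab vcompA (reassoc (eq_sym (proj2_sig (fmor K a)))) /=.
  by rewrite !vcompA (reassoc (eq_sym (lwhisker_vcomp _ _ _))) ba hcomp_id vcomp1m.
(* Fullness of the comparison functor lifts [b], now a coalgebra morphism, to a 2-cell. *)
have [c Hc] := equivalence_full _ _ _ (comonadic_t X) g f (exist _ b Hb).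
by exists c; move: (f_equal (@proj1_sig _ _) Hc).
Qed.

End ComonadicComposition.

Theorem proposition3p1 (B : Bicategory)
    (all_maps_comonadic :
       forall (X A : B) (g : arr X A) (r : RightAdjoint g), comonadic r)
    (Map_has_terminal : exists T : Map B, is_terminal T) :
  locally_essentially_discrete (Map B).
Proof.
case: Map_has_terminal => T terminalT X A.
have [F [G _]] := terminalT A.
(* The inverse equivalence at the single object [tt] supplies a map [A -> T], here with a right
   adjoint [r]. *)
have [r] := proj2_sig (G tt).
have Hr := all_maps_comonadic _ _ _ r.
have thinXT := equivalent_terminal_thin _ (terminalT X).
apply: thin_groupoid_essentially_discrete => [f g a b | f g a].
- apply: (comonadic_faithful _ _ _ _ _ Hr).
  exact: (thinXT (map_comp1 (G tt) f) (map_comp1 (G tt) g)).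
(* Between maps [X -> T] a 2-cell exists in each direction; thinness makes [b] inverse to the
   whiskering of [a], so it lifts to a 2-cell [g -> f]. *)
- have [b] := equivalent_terminal_connected _
    (map_comp1 (G tt) g) (map_comp1 (G tt) f) (terminalT X).
  have [||c _] := comonadic_reflects_inverse _ _ _ _ _ Hr _ _ _ a b.
  + exact: (thinXT (map_comp1 (G tt) f) (map_comp1 (G tt) f)).
  + exact: (thinXT (map_comp1 (G tt) g) (map_comp1 (G tt) g)).
  + exact: inhabits c.
Qed.
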